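(* Let $(S,* )$ and $(T,\bullet)$ be semilattices of groups, let $\alpha$ and $\beta$ be involutive, idempotent-fixed automorphisms of $(S,* )$ and $(T,\bullet)$ respectively, and let $S(\alpha)$ and $T(\beta)$ be the groupoids determined by them. Then $\{S(\alpha)\}\cong\{T(\beta)\}$ if and only if $(S,* )\cong(T,\bullet)$.
   Context: A groupoid is a set with a binary operation. A semilattice of groups is a semigroup that is a semilattice of groups in the usual sense (a Clifford semigroup). An automorphism $\alpha$ is involutive if $\alpha^2$ is the identity mapping, and idempotent-fixed if $\alpha(e)=e$ for every idempotent $e$. The groupoid $S(\alpha)$ determined by $(S,* )$ and $\alpha$ is the set $S$ with product $xy=\alpha(x)*y$; likewise $T(\beta)$ is $T$ with product $xy=\beta(x)\bullet y$. A groupoid is an inverse groupoid if for every $a$ there is a unique element $a^{-1}$ such that $(aa^{-1})a=a$ and $(a^{-1}a)a^{-1}=a^{-1}$; $S(\alpha)$ and $T(\beta)$ are known to be inverse groupoids. The standard ternary operation of an inverse groupoid is $\{abc\}=(ab^{-1})c$, where $b^{-1}$ is the inverse in that groupoid; $\{S(\alpha)\}$ denotes $S$ with the standard ternary operation of $S(\alpha)$, and similarly for $\{T(\beta)\}$. Two ternary operations on $S$ and $T$ are isomorphic ($\cong$) if there is a bijection $\delta:S\to T$ with $\delta\{abc\}=\{(\delta a)(\delta b)(\delta c)\}$ for all $a,b,c\in S$. *)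

(* Defs.v *)
From HB Require Import structures.
From mathcomp Require Import all_boot all_order boolp.

Set Implicit Arguments.
Unset Strict Implicit.
Unset Printing Implicit Defensive.

Import Order.TTheory.
Local Open Scope group_scope.

(* [G] is a subgroup of the semigroup [S]; its identity is only required to be
   an identity for the elements of [G]. *)
Definition is_group (S : semigroupType) (G : S -> Prop) : Prop :=
  (forall x y, G x -> G y -> G (x * y)) /\
  exists e, [/\ G e,
    forall x, G x -> e * x = x /\ x * e = x &
    forall x, G x -> exists y, [/\ G y, y * x = e & x * y = e]].

(* [S] is the disjoint union of the groups [pi @^-1 i], indexed by the
   semilattice [Y], and the product of the i-th and the j-th group lies in the
   [i `&` j]-th one.  The groups are nonempty, so [pi] is onto. *)
Definition semilattice_of_groups (S : semigroupType) : Prop :=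
  exists (d : Order.disp_t) (Y : meetSemilatticeType d) (pi : S -> Y),
    (forall x y, pi (x * y) = (pi x `&` pi y)%O) /\
    (forall i, is_group (fun x => pi x = i)).

Definition automorphism (S : magmaType) (alpha : S -> S) : Prop :=
  {morph alpha : x y / x * y} /\ bijective alpha.

Definition idempotent_fixed (S : magmaType) (alpha : S -> S) : Prop :=
  forall e, e * e = e -> alpha e = e.

Definition magma_isomorphic (S T : magmaType) : Prop :=
  exists2 f : S -> T, bijective f & {morph f : x y / x * y}.

(* The groupoid S(alpha), as an alias of the carrier of [S]. *)
Definition twist (S : magmaType) (alpha : S -> S) : Type := S.
HB.instance Definition _ (S : magmaType) (alpha : S -> S) :=
  hasMul.Build (twist alpha) (fun x y : S => alpha x * y).

Definition is_inverse (G : magmaType) (a b : G) : Prop :=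
  (a * b) * a = a /\ (b * a) * b = b.

Definition inverse_groupoid (G : magmaType) : Prop :=
  forall a : G, exists! b : G, is_inverse a b.

Definition groupoid_inv (G : magmaType) (GI : inverse_groupoid G) (a : G) : G :=
  sval (cid (GI a)).

Definition std_ternary (G : magmaType) (GI : inverse_groupoid G) (a b c : G)
  : G := (a * groupoid_inv GI b) * c.

Definition ternary_isomorphic (A B : Type)
    (tA : A -> A -> A -> A) (tB : B -> B -> B -> B) : Prop :=
  exists2 delta : A -> B, bijective delta &
    forall a b c, delta (tA a b c) = tB (delta a) (delta b) (delta c).

Lemma groupoid_invP (G : magmaType) (GI : inverse_groupoid G) (a : G) :
  is_inverse a (groupoid_inv GI a).
Proof. by rewrite /groupoid_inv; case: cid => b []. Qed.

Lemma twist_inverse_groupoid (S : semigroupType) (alpha : S -> S) :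
  semilattice_of_groups S -> automorphism alpha -> involutive alpha ->
  inverse_groupoid (twist alpha).
Proof.
move=> [d [Y [pi [piM piG]]]] [aM _] aK a.
have [_ [e [Ge eid einv]]] := piG (pi a).
have [y [Gy ya ay]] := einv a erefl.
have mulE (u v : S) : (u : twist alpha) * (v : twist alpha) = alpha u * v by [].
exists (alpha y); split.
  split; rewrite !mulE !aM !aK; first by rewrite ay (eid a erefl).1.
  by rewrite -!aM ya (eid y Gy).1.
move=> b []; rewrite !mulE !aM aK => aba /(congr1 alpha).
rewrite !aM !aK => bab.
apply: (can_inj aK); rewrite aK.
have Gb : pi (alpha b) = pi a.
  have := congr1 pi aba; rewrite !piM meetAC meetxx => pia.
  by have := congr1 pi bab; rewrite !piM meetAC meetxx meetC pia.
rewrite -{1}(eid y Gy).1 -ya -{1}aba -!mulgA ay (eid _ Gb).2.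
by rewrite !mulgA ya (eid _ Gb).1.
Qed.

(* Main.v *)
(** Since [alpha] is an involutive automorphism, the inverse of [b] in S(alpha)
    is [alpha b'], with [b'] the inverse of [b] in the Clifford semigroup S;
    hence [(a b^-1) c] in S(alpha) is just [a b' c], in which [alpha] no longer
    occurs.  An isomorphism of semigroups preserves this operation.  Conversely,
    if [delta] preserves it then, with [x^0 = x x'], the map
    [x |-> (delta x^0)' (delta x)] is an isomorphism of semigroups: it is
    multiplicative because [x y = x (y^0)' y] and [x^0 y^0 = x^0 (y^0)' y^0]. *)
Require Import Defs.
From mathcomp Require Import all_boot all_order boolp.

Set Implicit Arguments.
Unset Strict Implicit.
Unset Printing Implicit Defensive.

Import Order.TTheory.
Local Open Scope group_scope.

(** Equational form of a Clifford semigroup: completely regular with central idempotents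
    [x * inv x]. The isomorphism argument below uses only these identities. *)
Definition clifford_inverse (S : semigroupType) (inv : S -> S) : Prop :=
  [/\ forall x, x * inv x * x = x,
      forall x, inv x * x * inv x = inv x,
      forall x, inv x * x = x * inv x &
      forall x y, x * inv x * y = y * (x * inv x)].

(** Inverses are taken inside each group. Centrality holds because the identity [e i] acts trivially
    on every group whose index is below [i]. *)
Lemma semilattice_of_groups_clifford (S : semigroupType) :
  semilattice_of_groups S -> exists inv : S -> S, clifford_inverse inv.
Proof.
move=> [d [Y [pi [piM piG]]]].
have [e eP] := choice (fun i => (piG i).2).
have pie i : pi (e i) = i by case: (eP i).
have elr i x : pi x = i -> e i * x = x /\ x * e i = x by case: (eP i) => _ + _; apply.
have ex_inv x : exists y, [/\ pi y = pi x, y * x = e (pi x) & x * y = e (pi x)].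
  by case: (eP (pi x)) => _ _; apply.
have [inv invP] := choice ex_inv.
have idem i g : pi g = i -> g * g = g -> g = e i.
  move=> gi gg; have [_ yg _] := invP g.
  by rewrite gi in yg; rewrite -yg -{3}gg mulgA yg (elr i g gi).1.
have absl i z : (pi z <= i)%O -> e i * z = z.
  move=> zi; set g := e (pi z).
  have pieg : pi (e i * g) = pi z by rewrite piM !pie; apply/meet_idPr.
  have -> : z = g * z by rewrite (elr _ z erefl).1.
  (* [e i * g] is an idempotent of the group of [z], hence its identity [g]. *)
  rewrite mulgA; congr (_ * _); apply: idem => //.
  by rewrite -mulgA [g * _](elr _ _ pieg).1 mulgA (elr _ _ (pie i)).1.
have absr i z : (pi z <= i)%O -> z * e i = z.
  move=> zi; set g := e (pi z).
  have pige : pi (g * e i) = pi z by rewrite piM !pie; apply/meet_idPl.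
  have -> : z = z * g by rewrite (elr _ z erefl).2.
  rewrite -mulgA; congr (_ * _); apply: idem => //.
  by rewrite mulgA [_ * g](elr _ _ pige).2 -mulgA (elr _ _ (pie i)).1.
have central i z : e i * z = z * e i.
  set g := e (i `&` pi z)%O.
  have gz : pi (g * z) = (i `&` pi z)%O by rewrite piM pie -meetA meetxx.
  have zg : pi (z * g) = (i `&` pi z)%O by rewrite piM pie meetC -meetA meetxx.
  have ez : pi (e i * z) = (i `&` pi z)%O by rewrite piM pie.
  have ze : pi (z * e i) = (i `&` pi z)%O by rewrite piM pie meetC.
  (* Both sides lie in the group with identity [g]. Multiplying by [g] lets [e i] be absorbed, which
     leaves [z * g = g * z]; both of these equal [g * z * g]. *)
  rewrite -(elr _ _ ez).2 -(elr _ _ ze).1 -/g -mulgA absl ?zg ?leIl //.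
  rewrite mulgA (absr i) ?gz ?leIl //.
  by rewrite -(elr _ _ gz).2 -(elr _ _ zg).1 mulgA.
exists inv; split=> [x|x|x|x y]; have [pix yx xy] := invP x.
- by rewrite xy (elr _ x erefl).1.
- by rewrite yx (elr _ _ pix).1.
- by rewrite yx xy.
- by rewrite xy central.
Qed.

(** Centrality forces [b * a] and [a * b] to equal [a * inv a], so [b = b * a * b] reduces to
    [inv a * a * inv a]. *)
Lemma clifford_inverse_uniq (S : semigroupType) (inv : S -> S) (a b : S) :
  clifford_inverse inv -> is_inverse a b -> b = inv a.
Proof.
move=> [xVx VxV VC cen] [aba bab].
have ba : b * a = inv a * a.
  rewrite -{1}(xVx a) cen (mulgA b) -cen -VC -mulgA.
  by rewrite (mulgA a b) aba.
have ab : a * b = a * inv a.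
  by rewrite -{1}(xVx a) -mulgA cen mulgA aba.
by rewrite -bab ba -mulgA ab mulgA VxV.
Qed.

Lemma std_ternary_twist (S : semigroupType) (inv : S -> S) (alpha : S -> S)
    (HS : semilattice_of_groups S) (alphaA : automorphism alpha)
    (alphaI : involutive alpha) (a b c : S) :
  clifford_inverse inv ->
  std_ternary (twist_inverse_groupoid HS alphaA alphaI) a b c = a * inv b * c.
Proof.
move=> [xVx VxV _ _]; have [aM _] := alphaA.
rewrite /std_ternary; set GI := twist_inverse_groupoid _ _ _.
have mulE (u v : S) : (u : twist alpha) * (v : twist alpha) = alpha u * v by [].
have -> : groupoid_inv GI b = alpha (inv b).
  have [y [_ yuniq]] := GI b.
  rewrite -(yuniq _ (groupoid_invP GI b)); apply: yuniq; split.
    by rewrite !mulE !aM !alphaI xVx.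
  by rewrite !mulE !aM !alphaI -!aM VxV.
by rewrite !mulE !aM !alphaI.
Qed.

Lemma clifford_morph_inverse (S T : semigroupType) (inv : S -> S) (inv' : T -> T)
    (f : S -> T) (x : S) :
  clifford_inverse inv -> clifford_inverse inv' -> {morph f : x y / x * y} ->
  f (inv x) = inv' (f x).
Proof.
move=> [xVx VxV _ _] inv'P fM.
by apply: clifford_inverse_uniq inv'P _; split; rewrite -!fM ?xVx ?VxV.
Qed.

Lemma clifford_inverseM (S : semigroupType) (inv : S -> S) (x y : S) :
  clifford_inverse inv -> inv (x * y) = inv y * inv x.
Proof.
move=> invP; have [xVx VxV VC cen] := invP.
apply/esym/(clifford_inverse_uniq invP); split.
  have -> : x * y * (inv y * inv x) * (x * y) = x * (y * inv y * (inv x * x)) * y.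
    by rewrite !mulgA.
  by rewrite cen !mulgA xVx -!(mulgA x) xVx.
have -> : inv y * inv x * (x * y) * (inv y * inv x)
    = inv y * (inv x * x * (y * inv y)) * inv x by rewrite !mulgA.
by rewrite -(cen y) !mulgA VxV -!(mulgA (inv y)) VxV.
Qed.

(** The idempotent [x^0]: the identity of the maximal subgroup containing [x]. *)
Definition clifford_unit (S : semigroupType) (inv : S -> S) (x : S) : S :=
  x * inv x.

Lemma clifford_unitM (S : semigroupType) (inv : S -> S) (x y : S) :
  clifford_inverse inv ->
  clifford_unit inv (x * y) = clifford_unit inv x * clifford_unit inv y.
Proof.
move=> invP; have [_ _ _ cen] := invP.
rewrite /clifford_unit (clifford_inverseM _ _ invP).
by rewrite -(mulgA x y) (mulgA y) (cen y (inv x)) (mulgA x).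
Qed.

Lemma clifford_unit_inverse (S : semigroupType) (inv : S -> S) (x : S) :
  clifford_inverse inv -> clifford_unit inv (inv x) = clifford_unit inv x.
Proof.
move=> invP; have [xVx VxV VC _] := invP.
by rewrite /clifford_unit -(clifford_inverse_uniq (a := inv x) (b := x) invP).
Qed.

Lemma clifford_unit_idem (S : semigroupType) (inv : S -> S) (x : S) :
  clifford_inverse inv ->
  clifford_unit inv x * clifford_unit inv x = clifford_unit inv x.
Proof. by move=> [xVx _ _ _]; rewrite /clifford_unit !mulgA xVx. Qed.

Lemma clifford_unitK (S : semigroupType) (inv : S -> S) (x : S) :
  clifford_inverse inv ->
  clifford_unit inv (clifford_unit inv x) = clifford_unit inv x.
Proof.
move=> invP.
by rewrite {2}/clifford_unit clifford_unitM // clifford_unit_inverse //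
  clifford_unit_idem.
Qed.

Lemma clifford_inverse_unit (S : semigroupType) (inv : S -> S) (x : S) :
  clifford_inverse inv -> inv (clifford_unit inv x) = clifford_unit inv x.
Proof.
move=> invP; have [xVx _ _ _] := invP.
by apply/esym/(clifford_inverse_uniq invP); split; rewrite /clifford_unit !mulgA !xVx.
Qed.

(** If [u] and [v] share a group then [u * inv u * v = v]; applying [delta] puts the unit of
    [delta v] below that of [delta u]. Exchanging [u] and [v] gives equality. *)
Lemma clifford_ternary_unit (S T : semigroupType) (inv : S -> S) (inv' : T -> T)
    (delta : S -> T) (x y : S) :
  clifford_inverse inv -> clifford_inverse inv' ->
  (forall a b c,
    delta (a * inv b * c) = delta a * inv' (delta b) * delta c) ->
  clifford_unit inv x = clifford_unit inv y ->
  clifford_unit inv' (delta x) = clifford_unit inv' (delta y).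
Proof.
move=> invP inv'P dP.
have le u v : clifford_unit inv u = clifford_unit inv v ->
    clifford_unit inv' (delta v)
    = clifford_unit inv' (delta u) * clifford_unit inv' (delta v).
  have [xVx _ _ _] := invP => uv.
  have /(congr1 delta) : u * inv u * v = v.
    by rewrite -/(clifford_unit inv u) uv xVx.
  rewrite dP => /(congr1 (clifford_unit inv')).
  by rewrite clifford_unitM // -/(clifford_unit inv' (delta u)) clifford_unitK.
move=> xy; have [_ _ _ cen] := inv'P.
by rewrite (le _ _ xy) [LHS](le _ _ (esym xy)) [RHS]cen.
Qed.

Lemma clifford_ternary_isomorphic (S T : semigroupType)
    (inv : S -> S) (inv' : T -> T) :
  clifford_inverse inv -> clifford_inverse inv' ->
  ternary_isomorphic (fun a b c => a * inv b * c) (fun a b c => a * inv' b * c)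
  <-> magma_isomorphic S T.
Proof.
move=> invP inv'P; split; last first.
  move=> [f bij_f fM]; exists f => // a b c.
  by rewrite !fM (clifford_morph_inverse _ invP inv'P fM).
move=> [delta [delta' dK d'K] dP].
have d'P a b c : delta' (a * inv' b * c) = delta' a * inv (delta' b) * delta' c.
  by apply: (can_inj dK); rewrite dP !d'K.
have unitD := clifford_ternary_unit invP inv'P dP.
have unitD' := clifford_ternary_unit inv'P invP d'P.
have [[xVx _ _ _] [xVx' _ VC' cen']] := (invP, inv'P).
(* [u x] need not be idempotent, but it lies in the group of [delta x], so [f] can divide by it
   there. *)
pose u x := delta (clifford_unit inv x).
have unit_u x : clifford_unit inv' (u x) = clifford_unit inv' (delta x).
  by apply: unitD; rewrite clifford_unitK.
have unitl x : clifford_unit inv' x * x = x by rewrite /clifford_unit.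
pose f x := inv' (u x) * delta x.
(* Solving [y = f x] gives [delta x = u x * y]. Here [x] and [delta' y] lie in the same group, on
   which [u] is constant, so [u x = u (delta' y)]. *)
pose g y := delta' (u (delta' y) * y).
exists f.
  exists g => [x|y].
    have e1 : clifford_unit inv (delta' (f x)) = clifford_unit inv x.
      rewrite -[in RHS](dK x); apply: unitD'.
      by rewrite clifford_unitM // clifford_unit_inverse // unit_u clifford_unit_idem.
    rewrite /g {1}/u e1 -/(u x) /f mulgA -/(clifford_unit inv' (u x)).
    by rewrite unit_u unitl.
  have e1 : clifford_unit inv (g y) = clifford_unit inv (delta' y).
    apply: unitD'; rewrite clifford_unitM // unit_u d'K.
    by rewrite clifford_unit_idem.
  rewrite /f {1}/u e1 -/(u _) /g d'K mulgA VC' -/(clifford_unit inv' _).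
  by rewrite unit_u d'K unitl.
move=> x y.
have uM : u (x * y) = u x * clifford_unit inv' (delta y).
  rewrite -unit_u /clifford_unit -VC' mulgA -dP clifford_inverse_unit // -mulgA.
  rewrite /u clifford_unitM //; congr (delta (_ * _)).
  by rewrite clifford_unit_idem.
have dM : delta (x * y) = delta x * inv' (u y) * delta y.
  rewrite -dP clifford_inverse_unit // -mulgA; congr (delta (_ * _)).
  by rewrite /clifford_unit.
(* The only surplus factor in [f (x * y)] is the unit of [delta y]; being central, it moves next to
   [delta y] and is absorbed. *)
rewrite /f uM dM (clifford_inverseM _ _ inv'P) (clifford_inverse_unit _ inv'P).
rewrite /clifford_unit cen' -!mulgA; congr (_ * _).
by rewrite (mulgA (delta y)) cen' -!mulgA -cen' xVx'.
Qed.

Theorem theorem29 (S T : semigroupType)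
    (HS : semilattice_of_groups S) (HT : semilattice_of_groups T)
    (alpha : S -> S) (beta : T -> T)
    (alphaA : automorphism alpha) (betaA : automorphism beta)
    (alphaI : involutive alpha) (betaI : involutive beta)
    (alphaE : idempotent_fixed alpha) (betaE : idempotent_fixed beta) :
  ternary_isomorphic
    (std_ternary (twist_inverse_groupoid HS alphaA alphaI))
    (std_ternary (twist_inverse_groupoid HT betaA betaI))
  <-> magma_isomorphic S T.
Proof.
have [inv invP] := semilattice_of_groups_clifford HS.
have [inv' inv'P] := semilattice_of_groups_clifford HT.
(* Both sides now concern the same ternary operations, so one [delta] serves in each direction. *)
rewrite -(clifford_ternary_isomorphic invP inv'P).
split=> -[delta bij_delta dP]; exists delta => // a b c; move: (dP a b c);
  rewrite (std_ternary_twist _ _ _ _ _ _ invP)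
    (std_ternary_twist _ _ _ _ _ _ inv'P); exact.
Qed.
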